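(* Let $X=\overline{\{T_\omega(\mathfrak{J}):\omega\in\mathbb{F}_2^+\}}$ be the orbit closure of the Jacaranda tree $\mathfrak{J}$, let $Y=\{a,b\}^{\mathbb{N}}\times X$, and let $F:Y\to Y$ be the skew-product $$F(\omega,\mathfrak{A})=(\sigma(\omega),T_{\omega_0}(\mathfrak{A})),$$ where $\sigma$ is the unilateral shift on $\{a,b\}^{\mathbb{N}}$ and $\omega=\omega_0\omega_1\omega_2\ldots$. Then the topological entropy of $F$ is equal to $\log 2$.
   Context: $\mathbb{F}_2^+$ is the free monoid on two generators $a,b$ (finite words in $a,b$), with empty word $e$; $|\omega|$ is the length of $\omega$. A tree is an element $\mathfrak{A}=(\mathfrak{A}_\omega)_{\omega\in\mathbb{F}_2^+}$ of $\{0,1\}^{\mathbb{F}_2^+}$ (the root is the site $e$, and the left and right followers of the site $\omega$ are $\omega a$ and $\omega b$). The distance $d(\mathfrak{A},\mathfrak{B})$ between two distinct trees is $2^{-N}$ where $N$ is the minimal integer $n$ such that $\mathfrak{A}_\omega\ne\mathfrak{B}_\omega$ for some $|\omega|=n$; the space of trees is compact. For $\omega\in\mathbb{F}_2^+$, $T_\omega(\mathfrak{A})$ is the subtree of $\mathfrak{A}$ rooted at $\omega$: $(T_\omega(\mathfrak{A}))_\psi=\mathfrak{A}_{\omega\psi}$; in particular $T_a$, $T_b$ send a tree to its $a$-follower and $b$-follower subtrees. The map $H$ (substreetution with grammar BBAB) on trees is defined by: $H(\mathfrak{A})_e=\mathfrak{A}_e$, $H(\mathfrak{A})_a=1$, $H(\mathfrak{A})_b=0$,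 $T_{aa}(H(\mathfrak{A}))=H(T_b(\mathfrak{A}))$, $T_{ab}(H(\mathfrak{A}))=H(T_b(\mathfrak{A}))$, $T_{ba}(H(\mathfrak{A}))=H(T_a(\mathfrak{A}))$, $T_{bb}(H(\mathfrak{A}))=H(T_b(\mathfrak{A}))$. The Jacaranda tree $\mathfrak{J}$ is the unique tree with root $\mathfrak{J}_e=0$ and $H(\mathfrak{J})=\mathfrak{J}$. $Y$ carries the metric $d_Y((\omega,\mathfrak{A}),(\omega',\mathfrak{A}'))=\max(d_\Sigma(\omega,\omega'),d(\mathfrak{A},\mathfrak{A}'))$, where $d_\Sigma$ is the usual metric on $\{a,b\}^{\mathbb{N}}$ ($d_\Sigma(\omega,\omega')=2^{-k}$ with $k$ the first index where the distinct sequences $\omega,\omega'$ differ). The topological entropy is $h_{top}(F)=\lim_{\epsilon\to0}\limsup_{n\to+\infty}\frac1n\log r(n,\epsilon)$, with $r(n,\epsilon)$ the maximal cardinality of an $(n,\epsilon)$-separated set for $d_Y$. *)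

(* Defs.v *)
From HB Require Import structures.
From mathcomp Require Import all_boot all_order all_algebra.
From mathcomp Require Import all_classical all_reals all_analysis.

Set Implicit Arguments.
Unset Strict Implicit.
Unset Printing Implicit Defensive.

Import Order.TTheory GRing.Theory Num.Theory.
Import numFieldNormedType.Exports.

Local Open Scope classical_set_scope.
Local Open Scope card_scope.
Local Open Scope ring_scope.

(* Families indexed by [I], where the index [i] sits at level [lev i]: the
   distance between two distinct families is 2^-N, N being the least level at
   which they differ. *)
Section first_difference.
Context {R : realType} {I L : Type} (lev : I -> nat).
Implicit Types x y z : I -> L.

Definition differ_at x y : pred nat :=
  fun n => `[< exists2 i, lev i = n & x i <> y i >].

Definition diff_dist x y : R :=
  if pselect (exists n, differ_at x y n) is left h then 2^-1 ^+ ex_minn h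
  else 0.

Lemma differ_atC x y : differ_at x y = differ_at y x.
Proof.
by apply/funext => n; apply/asbool_equiv_eq; split=> -[i ? /nesym ?]; exists i.
Qed.

Lemma diff_dist_ge0 x y : 0 <= diff_dist x y.
Proof. by rewrite /diff_dist; case: pselect => // h; rewrite exprn_ge0. Qed.

Lemma diff_dist_ltP k x y :
  diff_dist x y < 2^-1 ^+ k <-> forall i, (lev i <= k)%N -> x i = y i.
Proof.
rewrite /diff_dist; case: pselect => [h|h].
- case: ex_minnP => m /asboolP[i mi xyi] mmin.
  have -> : ((2^-1 : R) ^+ m < 2^-1 ^+ k) = (k < m)%N.
    by rewrite ltr_iXn2l ?invr_gt0 ?invf_lt1 ?ltr0n ?ltr1n.
  split=> [km j jk|xy].
    apply: contrapT => xyj.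
    have dj : differ_at x y (lev j) by apply/asboolP; exists j.
    by have := leq_trans (mmin _ dj) jk; rewrite leqNgt km.
  by rewrite ltnNge; apply/negP => mk; apply: xyi; apply: xy; rewrite mi.
- split=> [_ j _|_]; last by rewrite exprn_gt0 ?invr_gt0 ?ltr0n.
  apply: contrapT => xyj; apply: h.
  by exists (lev j); apply/asboolP; exists j.
Qed.

Lemma diff_distxx x : diff_dist x x = 0.
Proof.
by rewrite /diff_dist; case: pselect => // h; have [n /asboolP[]] := h.
Qed.

Lemma diff_dist_eq0 x y : diff_dist x y = 0 -> x = y.
Proof.
move=> xy0; apply/funext => i.
have /diff_dist_ltP : diff_dist x y < 2^-1 ^+ lev i.
  by rewrite xy0 exprn_gt0 ?invr_gt0 ?ltr0n.
exact.
Qed.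

Lemma diff_distC x y : diff_dist x y = diff_dist y x.
Proof. by rewrite /diff_dist differ_atC. Qed.

Lemma diff_dist_triangle y x z :
  diff_dist x z <= diff_dist x y + diff_dist y z.
Proof.
rewrite [leLHS]/diff_dist; case: pselect => [h|_]; last first.
  by rewrite addr_ge0 ?diff_dist_ge0.
case: ex_minnP => m /asboolP[i mi xzi] _.
rewrite leNgt; apply/negP => lt_m.
have /diff_dist_ltP xy : diff_dist x y < 2^-1 ^+ m.
  by apply: le_lt_trans lt_m; rewrite lerDl diff_dist_ge0.
have /diff_dist_ltP yz : diff_dist y z < 2^-1 ^+ m.
  by apply: le_lt_trans lt_m; rewrite lerDr diff_dist_ge0.
by apply: xzi; rewrite xy ?mi// yz ?mi.
Qed.

End first_difference.

Section prod_metric.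
Context {R : realType} {T U : metricType R}.
Implicit Types p q : T * U.

Let dist p q : R := Num.max (mdist p.1 q.1) (mdist p.2 q.2).

Let dist_ge0 p q : 0 <= dist p q.
Proof. by rewrite le_max mdist_ge0. Qed.

Let dist_positivity p q : dist p q = 0 -> p = q.
Proof.
case: p q => [x u] [y v]; rewrite /dist/= => m0.
have : Num.max (mdist x y) (mdist u v) <= 0 by rewrite m0.
rewrite ge_max => /andP[xy uv].
congr (_, _); apply: mdist_positivity; apply/le_anti.
- by rewrite xy mdist_ge0.
- by rewrite uv mdist_ge0.
Qed.

Let ballEdist p (e : R) : ball p e = [set q | dist p q < e].
Proof.
apply/seteqP; split=> -[y v]; rewrite /dist/ball/= /prod_ball/= !ballEmdist/=.
- by move=> [? ?]; rewrite gt_max; apply/andP.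
- by rewrite gt_max => /andP[].
Qed.

HB.instance Definition _ := @PseudoMetric_isMetric.Build R (T * U)%type
  dist dist_ge0 dist_positivity ballEdist.

Lemma mdist_prodE p q :
  mdist p q = Num.max (mdist p.1 q.1) (mdist p.2 q.2).
Proof. by []. Qed.

End prod_metric.

Section topological_entropy.
Context {R : realType} {T : metricType R} (Y : set T) (f : T -> T).
Local Open Scope ereal_scope.

Definition bowen_dist (n : nat) (x y : T) : R :=
  \big[Num.max/0%R]_(i < n) mdist (iter i f x) (iter i f y).

Definition separated (n : nat) (eps : R) (S : set T) : Prop :=
  forall x y, S x -> S y -> x <> y -> (eps < bowen_dist n x y)%R.

(* r(n, eps): the maximal cardinality of an (n, eps)-separated subset of Y, understood as
   +oo if there is no bound (which cannot happen for a compact Y and a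
   continuous f). *)
Definition max_separated (n : nat) (eps : R) : \bar R :=
  ereal_sup [set k%:R%:E | k in
    [set k : nat | exists S, [/\ S `<=` Y, separated n eps S & S #= `I_k]]].

Definition separated_growth (eps : R) : \bar R :=
  limn_esup (fun n => (n%:R^-1)%:E * lne (max_separated n eps)).

(* Entropy of the restriction of f to Y, for Y stable under f. *)
Definition htop : \bar R := lim (separated_growth @ 0^'+).

Lemma max_separated_ge0 n eps : 0 <= max_separated n eps.
Proof.
apply: ereal_sup_ubound; exists 0%N => //.
by exists set0; split => //; rewrite II0 card_eq0 eqxx.
Qed.

Lemma le_max_separated n (e1 e2 : R) : (e1 <= e2)%R ->
  max_separated n e2 <= max_separated n e1.
Proof.
move=> e12; apply: le_ereal_sup => _ [k [S [SY sepS Sk]] <-].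
exists k => //; exists S; split=> // x y Sx Sy xy.
exact: le_lt_trans e12 (sepS _ _ Sx Sy xy).
Qed.

Lemma le_separated_growth (e1 e2 : R) : (e1 <= e2)%R ->
  separated_growth e2 <= separated_growth e1.
Proof.
move=> e12; apply: le_ereal_inf_tmp => _ [V Voo <-].
apply: (@le_trans _ _ (ereal_sup
  [set (n%:R^-1)%:E * lne (max_separated n e2) | n in V])).
  by apply: ereal_inf_lbound; exists V.
apply: ge_ereal_sup => _ [n Vn <-].
apply: (@le_trans _ _ ((n%:R^-1)%:E * lne (max_separated n e1))).
  apply: lee_wpmul2l; first by rewrite lee_fin invr_ge0.
  by rewrite lee_lne ?in_itv/= ?max_separated_ge0 ?leey// le_max_separated.
by apply: ereal_sup_ubound; exists n.
Qed.

Lemma htop_is_cvg : cvg (separated_growth @ 0^'+).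
Proof.
apply: nonincreasing_at_right_is_cvge; apply: nearW => b e1 e2 _ _.
exact: le_separated_growth.
Qed.

End topological_entropy.

Inductive letter := La | Lb.

Notation word := (seq letter).

(* The parameter R only selects the field in which distances take values. *)
Definition tree (R : realType) : Type := word -> bool.
Definition letter_seq (R : realType) : Type := nat -> letter.

Section metrics.
Context {R : realType}.

HB.instance Definition _ := gen_eqMixin (tree R).
HB.instance Definition _ := gen_choiceMixin (tree R).
HB.instance Definition _ := @isMetric.Build R (tree R) (diff_dist size)
  (diff_distxx size) (@diff_dist_eq0 R _ _ size) (diff_distC size)
  (diff_dist_triangle size).

HB.instance Definition _ := gen_eqMixin (letter_seq R).
HB.instance Definition _ := gen_choiceMixin (letter_seq R).
HB.instance Definition _ := @isMetric.Build R (letter_seq R) (diff_dist id)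
  (diff_distxx id) (@diff_dist_eq0 R _ _ id) (diff_distC id)
  (diff_dist_triangle id).

End metrics.

Section jacaranda.
Context {R : realType}.
Implicit Types A : tree R.

Definition subtree (w : word) A : tree R := fun v => A (w ++ v).

Fixpoint substreetution_at A (w : word) {struct w} : bool :=
  match w with
  | [::] => A [::]
  | [:: La] => true
  | [:: Lb] => false
  | La :: La :: v => substreetution_at (subtree [:: Lb] A) v
  | La :: Lb :: v => substreetution_at (subtree [:: Lb] A) v
  | Lb :: La :: v => substreetution_at (subtree [:: La] A) v
  | Lb :: Lb :: v => substreetution_at (subtree [:: Lb] A) v
  end.

Definition substreetution A : tree R := substreetution_at A.

Lemma substreetutionE A :
  [/\ substreetution A [::] = A [::],
      substreetution A [:: La] = true & substreetution A [:: Lb] = false] /\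
  [/\ subtree [:: La; La] (substreetution A) =
        substreetution (subtree [:: Lb] A),
      subtree [:: La; Lb] (substreetution A) =
        substreetution (subtree [:: Lb] A),
      subtree [:: Lb; La] (substreetution A) =
        substreetution (subtree [:: La] A) &
      subtree [:: Lb; Lb] (substreetution A) =
        substreetution (subtree [:: Lb] A)].
Proof. by []. Qed.

Definition is_jacaranda A : Prop := A [::] = false /\ substreetution A = A.

(* The labels of [substreetution A] up to level n+1 depend only on the labels
   of A up to level n. *)
Lemma substreetution_agree n A B :
  (forall w, (size w <= n)%N -> A w = B w) ->
  forall w, (size w <= n.+1)%N -> substreetution A w = substreetution B w.
Proof.
rewrite /substreetution => + w; move: {2}(size w) (leqnn (size w)) => m.
elim: m n A B w => [|m IH] n A B [|x [|y w]] //= sw AB.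
- by move=> _; rewrite AB.
- by move=> _; rewrite AB.
- rewrite !ltnS => wn; have {}sw : (size w <= m)%N by exact: ltnW.
  have rec z : substreetution_at (subtree [:: z] A) w =
               substreetution_at (subtree [:: z] B) w.
    case: n wn AB => // n wn AB.
    by apply: (IH n) => // [v vn|]; [exact: AB | exact: leqW].
  by case: x; case: y; rewrite rec.
Qed.

Lemma jacaranda_exists : exists! A, is_jacaranda A.
Proof.
pose S n := iter n substreetution (fun=> false).
have S1 n : forall w, (size w <= n)%N -> S n w = S n.+1 w.
  by elim: n => [[]//|n IH]; exact: substreetution_agree.
have Sle n m w : (size w <= n)%N -> (n <= m)%N -> S n w = S m w.
  move=> wn /subnK <-; elim: (m - n)%N => // k ->.
  by rewrite addSn S1// (leq_trans wn) ?leq_addl.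
pose J : tree R := fun w => S (size w) w.
have JS n w : (size w <= n)%N -> J w = S n w by move=> wn; exact: Sle.
exists J; split; first split=> //.
  apply/funext => w; rewrite [RHS](JS (size w).+1)//=.
  by apply: (@substreetution_agree (size w)) => // v; exact: JS.
move=> B [B0 HB].
suff JB n w : (size w <= n)%N -> J w = B w by apply/funext => w; exact: JB.
move=> wn; rewrite (JS n)//.
elim: n w wn => [[]//|n IH] w wn.
by rewrite -HB; exact: (@substreetution_agree n).
Qed.

Definition jacaranda : tree R := sval (cid jacaranda_exists).

Lemma jacarandaP : is_jacaranda jacaranda.
Proof. by rewrite /jacaranda; case: cid => J []. Qed.

Definition orbit_closure A : set (tree R) :=
  closure (range (fun w => subtree w A)).

Definition skew_product (p : letter_seq R * tree R) : letter_seq R * tree R :=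
  (fun n => p.1 n.+1, subtree [:: p.1 0%N] p.2).

Definition skew_space : set (letter_seq R * tree R) :=
  setT `*` orbit_closure jacaranda.

Lemma orbit_closureP A B : orbit_closure A B <->
  forall n, exists u, forall w, (size w <= n)%N -> B w = A (u ++ w).
Proof.
split=> [AB n|AB U].
- have e0 : 0 < (2^-1 : R) ^+ n by rewrite exprn_gt0 ?invr_gt0 ?ltr0n.
  have [_ [[u _ <-]]] := AB _ (nbhsx_ballx B (PosNum e0)%:num e0).
  by rewrite ballEmdist/= => /diff_dist_ltP Bu; exists u.
- move=> /nbhs_ballP[e/= e0 BU].
  have [n ne] : exists n, (2^-1 : R) ^+ n < e.
    have h : (GRing.exp (2^-1 : R)) @ \oo --> (0 : R).
      by apply: cvg_expr; rewrite ger0_norm ?invf_lt1 ?ltr1n.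
    have /cvgr0Pnorm_lt/(_ _ e0)[n _ /(_ n (leqnn n))] := h.
    by rewrite /= ger0_norm ?exprn_ge0//; exists n.
  have [u Bu] := AB n.
  exists (subtree u A); split; first by exists u.
  apply: BU; rewrite ballEmdist/=; apply: lt_trans ne.
  exact/diff_dist_ltP.
Qed.

Lemma skew_product_stable p : skew_space p -> skew_space (skew_product p).
Proof.
case: p => s A [_ /=/orbit_closureP XA]; split=> //=; apply/orbit_closureP => n.
have [u Au] := XA n.+1; exists (rcons u (s 0%N)) => w wn.
by rewrite /subtree Au//= cat_rcons.
Qed.

End jacaranda.

Arguments jacaranda : clear implicits.
Arguments skew_product : clear implicits.
Arguments skew_space : clear implicits.

(* Main.v *)
Require Import Defs.
From HB Require Import structures.
From mathcomp Require Import all_boot all_order all_algebra.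
From mathcomp Require Import all_classical all_reals all_analysis.
From mathcomp Require Import zify.

(** The skew product factors onto the full shift on two letters, which gives
    the lower bound: the 2^n words of length n, all paired with the Jacaranda
    tree J, are (n, eps)-separated for every eps < 1.

    For the upper bound, let collapse be the map sending each block of two
    letters of a word to a letter: ba to a and the other blocks to b.  The
    equation H(J) = J says that the label of J at a word of odd length is given
    by its last letter, and that the label at a word w of even length is the
    label at collapse w.  Hence, if 2^j is the largest power of 2 dividing
    |w| > 0, then J_w depends only on the last 2^j letters of w
    (jacaranda_suffix).

    Fix k and n and consider a point (s, A) of the skew space.  Up to level
    N = n + k, the tree A is the subtree of J at some word u.  Its first n
    iterates at precision 2^-k are determined by the N first letters of s and
    by the labels of A at the words s_0 .. s_(i-1) v with i < n and |v| <= k.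
    Let w be such a word.  If the largest power 2^j of 2 dividing |u| + |w|
    exists and is at most |w|, then the label of A at w can be read off w
    itself, once |u| is known modulo 2^(j+1).  Otherwise there is a j such that
    |w| < 2^j and 2^j divides |u| + |w|; for a given j this leaves a single
    possible height |w|, and if N <= 2^L the exponents j <= L account for all
    these exceptional heights (jacaranda_window).  At each of the L + 1 exceptional heights, the labels
    that matter are indexed by the words v of length at most k; let D be their
    number.  So the n first iterates at precision 2^-k are encoded by N letters,
    the residue of |u| modulo 2^L and (L + 1) D bits (itinerary_bowen), whence
    r(n, 2^-k) <= 2^(N + L + (L + 1) D).  Taking L of the order of log n, the
    exponent is n + o(n).

    Thus the exponential growth rate of r(n, eps) equals log 2 for every eps in
    ]0, 1[, and so does its limit as eps tends to 0. *)

Set Implicit Arguments.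
Unset Strict Implicit.

Import Order.TTheory GRing.Theory Num.Theory.
Import numFieldNormedType.Exports.

Local Open Scope classical_set_scope.
Local Open Scope ring_scope.
Local Open Scope ereal_scope.

(** * Letters and collapsed words *)

(** The label carried by a last letter at odd height: 1 for a and 0 for b. *)
Definition letter_bool (x : letter) : bool := if x is La then true else false.
Definition bool_letter (b : bool) : letter := if b then La else Lb.

Lemma letter_boolK : cancel letter_bool bool_letter.
Proof. by case. Qed.

Lemma bool_letterK : cancel bool_letter letter_bool.
Proof. by case. Qed.

HB.instance Definition _ := Finite.copy letter (can_type letter_boolK).

Lemma card_letter : #|{: letter}| = 2%N.
Proof.
by rewrite (bij_eq_card (Bijective letter_boolK bool_letterK)) card_bool.
Qed.

(** The grammar BBAB acting on words: each block of two letters is replaced by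
    the follower it designates, ba by a and the other blocks by b.  A last
    letter left unpaired is dropped. *)
Fixpoint collapse (w : word) : word :=
  match w with
  | x :: y :: v => (if (x, y) is (Lb, La) then La else Lb) :: collapse v
  | _ => [::]
  end.

Lemma size_collapse w : size (collapse w) = (size w)./2.
Proof.
move: {2}(size w) (leqnn (size w)) => m.
by elim: m w => [|m IH] [|x [|y w]] //= sw; rewrite IH // -ltnS; apply: ltnW.
Qed.

Lemma collapse_cat u v : ~~ odd (size u) ->
  collapse (u ++ v) = collapse u ++ collapse v.
Proof.
move: {2}(size u) (leqnn (size u)) => m.
elim: m u => [|m IH] [|x [|y u]] //= sw; rewrite negbK => e.
by rewrite IH // -ltnS; apply: ltnW.
Qed.

(** * Labels of the Jacaranda tree *)

Section jacaranda.
Context {R : realType}.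
Implicit Types (A : tree R) (w u v : word).

Lemma substreetution_even A w : ~~ odd (size w) ->
  substreetution A w = A (collapse w).
Proof.
rewrite /substreetution; move: {2}(size w) (leqnn (size w)) => m.
elim: m A w => [|m IH] A [|x [|y w]] //= sw; rewrite negbK => e.
by case: x; case: y; rewrite IH // -ltnS; apply: ltnW.
Qed.

Lemma substreetution_odd A w x : ~~ odd (size w) ->
  substreetution A (rcons w x) = letter_bool x.
Proof.
rewrite /substreetution; move: {2}(size w) (leqnn (size w)) => m.
elim: m A w => [|m IH] A [|y [|z w]] //= sw; try by case: {IH} x.
rewrite negbK => e.
by case: y; case: z; rewrite IH // -ltnS; apply: ltnW.
Qed.

(** The label of the Jacaranda tree at a word whose length is an odd multiple
    of 2^j depends only on the last 2^j letters of that word.  Collapsing halves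
    lengths, which allows an induction down to j = 0, where the label is given
    by the last letter. *)
Lemma jacaranda_suffix j u u' s : size s = (2 ^ j)%N ->
  (2 ^ j.+1 %| size u)%N -> (2 ^ j.+1 %| size u')%N ->
  jacaranda R (u ++ s) = jacaranda R (u' ++ s).
Proof.
have [_ HJ] := @jacarandaP R.
elim: j u u' s => [|j IH] u u' s ss du du'.
  case: s ss => [|x []]// _; rewrite -HJ !cats1.
  by rewrite !substreetution_odd // -dvdn2.
have ev w : (2 ^ j.+2 %| size w)%N -> ~~ odd (size w).
  by rewrite -dvdn2; apply: dvdn_trans; rewrite expnS dvdn_mulr.
have half w : (2 ^ j.+2 %| size w)%N -> (2 ^ j.+1 %| size (collapse w))%N.
  move=> /dvdnP[q e]; rewrite size_collapse e [(2 ^ j.+2)%N]expnS.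
  by rewrite mulnCA mul2n doubleK dvdn_mull.
have es : ~~ odd (size s) by rewrite ss oddX.
rewrite -HJ !substreetution_even ?size_cat ?oddD ?(negbTE es)
  ?(negbTE (ev _ du)) ?(negbTE (ev _ du'))//.
rewrite !collapse_cat ?ev//; apply: IH; rewrite ?half//.
by rewrite size_collapse ss expnS mul2n doubleK.
Qed.

(** Below two roots [u] and [u'] whose heights agree modulo 2^(j+1), the
    labels at [w] coincide when the height of [u ++ w] is an odd multiple of
    2^j and [w] has at least 2^j letters. *)
Lemma jacaranda_suffix_window j u u' w :
  size u = size u' %[mod 2 ^ j.+1] -> (2 ^ j %| size u + size w)%N ->
  ~~ (2 ^ j.+1 %| size u + size w)%N -> (2 ^ j <= size w)%N ->
  jacaranda R (u ++ w) = jacaranda R (u' ++ w).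
Proof.
move=> uu' dj ndj jw.
have dw x : (2 ^ j %| x + size w)%N -> ~~ (2 ^ j.+1 %| x + size w)%N ->
    (2 ^ j.+1 %| x + (size w - 2 ^ j))%N.
  rewrite addnBA// => /dvdnP[q ->]; rewrite expnS dvdn_pmul2r ?expn_gt0//.
  by move=> oq; rewrite -{3}[(2 ^ j)%N]mul1n -mulnBl dvdn_pmul2r ?expn_gt0//; lia.
have dvE d : (d %| 2 ^ j.+1)%N ->
    (d %| size u + size w)%N = (d %| size u' + size w)%N.
  by move=> dd; rewrite /dvdn -(modn_dvdm _ dd) -modnDml uu' modnDml modn_dvdm.
rewrite -(cat_take_drop (size w - 2 ^ j) w) !catA.
have st : size (take (size w - 2 ^ j) w) = (size w - 2 ^ j)%N.
  by rewrite size_takel // leq_subr.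
apply: (@jacaranda_suffix j); first by rewrite size_drop subKn.
  by rewrite size_cat st dw.
by rewrite size_cat st dw // -dvE // dvdn_exp2l.
Qed.

(** The height m < 2^j such that 2^j divides t + m: at depth m below a root of
    height t, the height is a multiple of 2^j although the last 2^j letters
    reach above the root.  The formula uses -t = t (2^j - 1) modulo 2^j. *)
Definition exceptional (t j : nat) : nat := ((t * (2 ^ j).-1) %% 2 ^ j)%N.

Lemma exceptionalP t j m : (m < 2 ^ j)%N -> (2 ^ j %| t + m)%N ->
  m = exceptional t j.
Proof.
move=> mj d; rewrite -[LHS](modn_small mj) /exceptional.
have p : (0 < 2 ^ j)%N by rewrite expn_gt0.
rewrite -[in LHS](modnMDl t m) -{1}(prednK p) mulnS addnAC -modnDml.
by rewrite (eqP d) add0n.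
Qed.

Lemma exceptional_mod t t' j : t = t' %[mod 2 ^ j] ->
  exceptional t j = exceptional t' j.
Proof. by rewrite /exceptional => e; rewrite -modnMml e modnMml. Qed.

(** Below two roots whose heights agree modulo 2^L, the labels of the Jacaranda
    tree at depth less than 2^L coincide everywhere as soon as they coincide at
    the L + 1 exceptional heights. *)
Lemma jacaranda_window L u u' w :
  size u = size u' %[mod 2 ^ L] -> (size w < 2 ^ L)%N ->
  (forall j, (j <= L)%N -> size w = exceptional (size u) j ->
    jacaranda R (u ++ w) = jacaranda R (u' ++ w)) ->
  jacaranda R (u ++ w) = jacaranda R (u' ++ w).
Proof.
move=> uu' wL ex.
have lo j : (j <= L)%N -> (2 ^ j %| size u + size w)%N ->
    (2 ^ j <= size w)%N \/ jacaranda R (u ++ w) = jacaranda R (u' ++ w).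
  move=> jL d; have [|wj] := leqP (2 ^ j) (size w); first by left.
  by right; apply: (ex j) => //; exact: exceptionalP.
have [dL|ndL] := boolP (2 ^ L %| size u + size w)%N.
  by have [|//] := lo L (leqnn L) dL; rewrite leqNgt wL.
(* [j] is the least exponent such that 2^j does not divide the height of
   [u ++ w]; that height is thus an odd multiple of 2^(j-1). *)
have [j] := ex_minnP (ex_intro (fun j => ~~ (2 ^ j %| size u + size w)%N) L ndL).
case: j => [|j]; first by rewrite dvd1n.
move=> ndj mn; have jL := mn _ ndL.
have dj : (2 ^ j %| size u + size w)%N.
  by apply: contraT => /mn; rewrite ltnn.
have [jw|//] := lo j (ltnW jL) dj.
apply: jacaranda_suffix_window ndj jw => //.
have dd := dvdn_exp2l 2 jL.
by rewrite -(modn_dvdm _ dd) uu' modn_dvdm.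
Qed.

End jacaranda.

(** * Bounding the size of separated sets by a finite coding *)

Lemma card_setT_fin (C : finType) : ([set: C] #= `I_#|C|)%card.
Proof.
have -> : `I_#|C| = [set nat_of_ord (enum_rank c) | c in [set: C]].
  apply/seteqP; split=> [i iC|_ [c _ <-]]; last exact: ltn_ord.
  by exists (enum_val (Ordinal iC)) => //; rewrite enum_valK.
rewrite card_eq_sym; apply: inj_card_eq => x y _ _ /ord_inj.
exact: enum_rank_inj.
Qed.

Section separated_sets.
Context {R : realType} {T : metricType R} (Y : set T) (f : T -> T).
Variables (n : nat) (eps : R) (C : finType).

(** Points with the same code are not separated, so a separated set injects
    into the codes. *)
Lemma max_separated_le_card (code : T -> C) :
  (forall x y, Y x -> Y y -> code x = code y -> bowen_dist f n x y <= eps)%R ->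
  (max_separated Y f n eps <= (#|C|%:R)%:E)%E.
Proof.
move=> codeP; apply: ge_ereal_sup => _ [k [S [SY sepS Sk]] <-].
rewrite lee_fin ler_nat -card_le_II.
have inj : {in S &, injective code}.
  move=> x y /set_mem Sx /set_mem Sy xy; apply: contrapT => nxy.
  have := sepS x y Sx Sy nxy; rewrite ltNge => /negP; apply.
  by apply: codeP => //; exact: SY.
rewrite -(card_le_eql Sk) -(card_le_eql (inj_card_eq inj)).
by rewrite -(card_le_eqr (card_setT_fin C)); exact/subset_card_le.
Qed.

Lemma max_separated_ge_card (g : C -> T) : (0 <= eps)%R ->
  (forall c, Y (g c)) ->
  (forall c c', c != c' -> eps < bowen_dist f n (g c) (g c'))%R ->
  ((#|C|%:R)%:E <= max_separated Y f n eps)%E.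
Proof.
move=> eps0 Yg sepg; apply: ereal_sup_ubound; exists #|C| => //.
exists (range g); split.
- by move=> _ [c _ <-].
- move=> _ _ [c _ <-] [c' _ <-] ncc; apply: sepg.
  by apply: contra_notN ncc => /eqP ->.
- apply: card_eq_trans (card_setT_fin C); apply: inj_card_eq => c c' _ _ gcc.
  apply/eqP; apply: contraT => /sepg; rewrite gcc => lt.
  suff : (bowen_dist f n (g c') (g c') <= eps)%R by rewrite leNgt lt.
  by apply: bigmax_le => // i _; rewrite mdistxx.
Qed.

End separated_sets.

(** * Sublinear growth of the length of the code *)

Lemma sqr_le_exp2 l : (l * l <= 2 * 2 ^ l)%N.
Proof.
elim: l => [//|l IH]; rewrite expnS.
have [l3|l3] := leqP 3 l; first by nia.
by case: l l3 {IH} => [|[|[|]]].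
Qed.

(** With N = n + k, the length of the code is n + o(n) for a suitable L.  The
    choice is one plus the integer part of log2 N. *)
Lemma code_length_sublinear k D M : exists n0, forall n, (n0 <= n)%N ->
  exists L, (n + k <= 2 ^ L)%N /\ (M * (k + L + L.+1 * D) <= n)%N.
Proof.
pose a := (M * D.+1)%N; pose b := (M * (k + 1 + 2 * D))%N.
exists (1 + k + 8 * (a * a) + 2 * b)%N => n nn.
have nk : (0 < n + k)%N by lia.
have l1 := @trunc_logP 2 (n + k) isT nk.
have l2 := @trunc_log_ltn 2 (n + k) isT.
set l := trunc_log 2 (n + k) in l1 l2.
exists l.+1; split; first exact: ltnW.
have -> : (M * (k + l.+1 + l.+2 * D) = a * l + b)%N.
  by rewrite /a /b; nia.
have sq := sqr_le_exp2 l.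
(* a l <= l^2 / 4 <= 2^l / 2 when 4 a <= l, and a l <= 4 a^2 otherwise. *)
suff : (2 * (a * l) <= 2 ^ l + 8 * (a * a))%N by lia.
have [la|la] := leqP l (4 * a).
  have : (a * l <= a * (4 * a))%N by rewrite leq_mul2l la orbT.
  by nia.
have : (4 * a * l <= l * l)%N by rewrite leq_mul2r (ltnW la) orbT.
by nia.
Qed.

(** * Itineraries of the skew product *)

Section dynamics.
Context {R : realType}.
Implicit Types (s : letter_seq R) (A : tree R).

Lemma iter_skew_product i s A : iter i (skew_product R) (s, A) =
  ((fun m => s (m + i)%N) : letter_seq R, subtree (mkseq s i) A).
Proof.
elim: i => [|i IH] /=.
  by congr (_, _); apply/funext => m; rewrite addn0.
rewrite IH /skew_product /=; congr (_, _).
  by apply/funext => m; rewrite addSnnS.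
by apply/funext => v; rewrite /subtree -[in RHS]addn1 /mkseq iotaD map_cat -catA.
Qed.

Lemma bowen_dist_skew_le n k (eps : R) s s' A A' :
  (2^-1 ^+ k <= eps)%R ->
  (forall m, (m < n + k)%N -> s m = s' m) ->
  (forall i v, (i < n)%N -> (size v <= k)%N ->
    A (mkseq s i ++ v) = A' (mkseq s' i ++ v)) ->
  (bowen_dist (skew_product R) n (s, A) (s', A') <= eps)%R.
Proof.
move=> keps ss AA; apply: bigmax_le => [|[i ni] _ /=].
  by apply: le_trans keps; rewrite exprn_ge0.
rewrite !iter_skew_product mdist_prodE ge_max.
apply/andP; split; apply: ltW; apply: lt_le_trans keps; apply/diff_dist_ltP.
  by move=> m mk; apply: ss; rewrite addnC -addSn leq_add.
by move=> v vk; exact: AA.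
Qed.

(** The first letters of the two sequences differ after m iterations, which puts
    the two orbits at distance at least 1. *)
Lemma bowen_dist_skew_ge1 n s s' A A' m : (m < n)%N -> s m <> s' m ->
  (1 <= bowen_dist (skew_product R) n (s, A) (s', A'))%R.
Proof.
move=> mn ssm; apply: le_trans (le_bigmax _ _ (Ordinal mn)) => /=.
rewrite !iter_skew_product mdist_prodE le_max leNgt; apply/orP; left.
apply/negP => lt; apply: ssm.
by have /(_ 0%N (leqnn _)) := (@diff_dist_ltP R _ _ id 0 _ _).1 lt.
Qed.

(** Codes made of N letters, a residue modulo 2^L and, for each of the L + 1
    exceptional heights, one bit for each word of length at most k. *)
Definition itinerary_code N L k : finType :=
  ({ffun 'I_N -> letter} * 'I_(2 ^ L) *
   {ffun 'I_L.+1 * {bseq k of letter} -> bool})%type.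

(** The code of a point (s, A) whose tree A looks like the subtree of the
    Jacaranda tree at [u]: the first N letters of s, the height of [u] modulo
    2^L, and the labels of A at exceptional height around the path s.  When a
    word [v] is longer than the exceptional height, the truncated subtraction
    is 0 and the bit is the label of A at [v], which plays no role. *)
Definition itinerary N L k (p : letter_seq R * tree R) (u : word) :
    itinerary_code N L k :=
  ([ffun i : 'I_N => p.1 i],
   Ordinal (ltn_pmod (size u) (expn_gt0 2 L)),
   [ffun jv : 'I_L.+1 * {bseq k of letter} =>
     p.2 (mkseq p.1 (exceptional (size u) jv.1 - size jv.2)%N ++ jv.2)]).

Lemma card_itinerary_code N L k : #|itinerary_code N L k| =
  (2 ^ (N + L + L.+1 * #|{: {bseq k of letter}}|))%N.
Proof.
rewrite !card_prod !card_ffun !card_prod !card_ord card_letter card_bool.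
by rewrite !expnD.
Qed.

(** If the trees of two points look like subtrees of the Jacaranda tree up to
    level n + k and the codes are equal, then the points stay 2^-k-close for n
    iterations. *)
Lemma itinerary_bowen n k L (eps : R) p p' u u' :
  (2^-1 ^+ k <= eps)%R -> (n + k <= 2 ^ L)%N ->
  (forall w, (size w <= n + k)%N -> p.2 w = jacaranda R (u ++ w)) ->
  (forall w, (size w <= n + k)%N -> p'.2 w = jacaranda R (u' ++ w)) ->
  itinerary (n + k) L k p u = itinerary (n + k) L k p' u' ->
  (bowen_dist (skew_product R) n p p' <= eps)%R.
Proof.
case: p p' => [s A] [s' A'] keps nkL /= Au Au' [/ffunP es eu /ffunP eA].
have ss m : (m < n + k)%N -> s m = s' m.
  by move=> mnk; have := es (Ordinal mnk); rewrite !ffunE.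
have es' i : (i <= n + k)%N -> mkseq s i = mkseq s' i.
  move=> ink; apply/eq_in_map => m; rewrite mem_iota => /andP[_ mi].
  by apply: ss; exact: leq_trans mi ink.
apply: (bowen_dist_skew_le (k := k)) => // i v ni vk.
have ivs : (size (mkseq s i ++ v) < n + k)%N.
  by rewrite size_cat size_mkseq -addSn leq_add.
have ink : (i <= n + k)%N by rewrite (leq_trans (ltnW ni)) ?leq_addr.
rewrite -es' // Au ?Au' 1?ltnW //.
apply: (jacaranda_window eu (leq_trans ivs nkL)) => j jL.
rewrite size_cat size_mkseq => ej.
have := eA (Ordinal (jL : (j < L.+1)%N), Bseq vk); rewrite !ffunE /=.
have <- : exceptional (size u) j = exceptional (size u') j.
  apply: exceptional_mod; have dd := dvdn_exp2l 2 jL.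
  by rewrite -(modn_dvdm _ dd) eu modn_dvdm.
by rewrite -ej addnK -es' // Au ?Au' 1?ltnW.
Qed.

Lemma max_separated_skew_le n k L (eps : R) :
  (2^-1 ^+ k <= eps)%R -> (n + k <= 2 ^ L)%N ->
  max_separated (skew_space R) (skew_product R) n eps <=
  ((2 ^ (n + k + L + L.+1 * #|{: {bseq k of letter}}|))%N%:R)%:E.
Proof.
move=> keps nkL.
have /choice[root rootP] : forall p : letter_seq R * tree R, exists u,
    skew_space R p ->
    forall w, (size w <= n + k)%N -> p.2 w = jacaranda R (u ++ w).
  move=> p.
  have [[_ /orbit_closureP/(_ (n + k)%N)[u Hu]]|np] := pselect (skew_space R p).
    by exists u.
  by exists [::].
rewrite -card_itinerary_code.
apply: (max_separated_le_card
  (code := fun p => itinerary (n + k) L k p (root p))).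
move=> p p' Yp Yp'; apply: itinerary_bowen => //; exact: rootP.
Qed.

Lemma max_separated_skew_ge n (eps : R) : (0 <= eps)%R -> (eps < 1)%R ->
  ((2 ^ n)%N%:R)%:E <= max_separated (skew_space R) (skew_product R) n eps.
Proof.
move=> eps0 eps1.
rewrite -card_letter -card_tuple.
(* The letters beyond the n first ones are all a. *)
pose g (t : n.-tuple letter) : letter_seq R * tree R :=
  (nth La t : letter_seq R, jacaranda R).
apply: (max_separated_ge_card (g := g)) => // [t|t t' tt].
  by split=> //=; apply/orbit_closureP => m; exists [::].
have [i ti] : exists i : 'I_n, tnth t i <> tnth t' i.
  apply: contrapT => h; move/eqP: tt; apply; apply: eq_from_tnth => i.
  by apply: contrapT => ti; apply: h; exists i.
apply: lt_le_trans eps1 _; apply: (@bowen_dist_skew_ge1 n _ _ _ _ i) => //.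
by rewrite -!tnth_nth.
Qed.

Lemma separated_growth_skew_le (eps : R) : (0 < eps)%R ->
  separated_growth (skew_space R) (skew_product R) eps <= (ln (2 : R)%R)%:E.
Proof.
move=> eps0.
have [k keps] : exists k, ((2^-1 : R) ^+ k <= eps)%R.
  have h : ((GRing.exp (2^-1 : R)%R) @ \oo --> (0 : R)%R)%classic.
    by apply: cvg_expr; rewrite ger0_norm ?invf_lt1 ?ltr1n.
  have /cvgr0Pnorm_lt/(_ _ eps0)[n _ /(_ n (leqnn n))] := h.
  by rewrite /= ger0_norm ?exprn_ge0// => /ltW; exists n.
apply/lee_addgt0Pr => d d0.
(* ln 2 <= 2 < M d, so an excess of at most n / M in the length of the code adds
   at most d to the growth rate. *)
pose M := (Num.bound (2 / d)).
have Md : (2 < M%:R * d)%R.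
  by rewrite -ltr_pdivrMr//; apply: archi_boundP; rewrite divr_ge0 ?ltW.
have [n0 n0P] := code_length_sublinear k #|{: {bseq k of letter}}| M.
apply: (@le_trans _ _ (ereal_sup
  [set ((n%:R : R)^-1)%:E *
    lne (max_separated (skew_space R) (skew_product R) n eps) |
    n in [set n | (n0.+1 <= n)%N]])).
  apply: ereal_inf_lbound; exists [set n | (n0.+1 <= n)%N] => //.
  exact: nbhs_infty_ge.
apply: ge_ereal_sup => _ [n /= nn <-].
have [L [nL]] := n0P n (ltnW nn).
set q := (k + L + _)%N => qn.
have n_gt0 : (0 < n%:R :> R)%R by rewrite ltr0n (leq_trans _ nn).
apply: (@le_trans _ _ ((n%:R^-1)%:E * lne ((2 ^ (n + q))%N%:R : R)%:E)).
  apply: lee_wpmul2l; first by rewrite lee_fin invr_ge0.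
  rewrite lee_lne ?in_itv/= ?max_separated_ge0 ?leey ?lee_fin ?ler0n//.
  rewrite /q [(n + _)%N]addnA [(n + (k + L))%N]addnA.
  exact: max_separated_skew_le.
rewrite lne_EFin ?ltr0n ?expn_gt0// natrX lnXn// -EFinM -EFinD lee_fin.
rewrite -[(ln _ *+ _)%R]mulr_natl natrD mulrDl mulrDr mulKf ?gt_eqF// lerD2l.
rewrite mulrC ler_pdivrMr//.
have ln2 : (ln (2 : R) <= 2)%R by apply/ltW/ln_sublinear.
apply: (@le_trans _ _ (q%:R * 2)%R); first by rewrite ler_wpM2l.
apply: (@le_trans _ _ (q%:R * (M%:R * d))%R); first by rewrite ler_wpM2l// ltW.
rewrite mulrA [leRHS]mulrC ler_pM2r// -natrM ler_nat.
by rewrite mulnC.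
Qed.

Lemma separated_growth_skew_ge (eps : R) : (0 <= eps)%R -> (eps < 1)%R ->
  (ln (2 : R)%R)%:E <= separated_growth (skew_space R) (skew_product R) eps.
Proof.
move=> eps0 eps1; apply: le_ereal_inf_tmp => _ [V [m _ mV] <-].
have n_gt0 : (0 < m.+1%:R :> R)%R by [].
apply: (@le_trans _ _ ((m.+1%:R^-1)%:E *
    lne (max_separated (skew_space R) (skew_product R) m.+1 eps))); last first.
  by apply: ereal_sup_ubound; exists m.+1 => //; apply: mV => /=.
apply: (@le_trans _ _ ((m.+1%:R^-1)%:E * lne ((2 ^ m.+1)%N%:R : R)%:E)).
  rewrite lne_EFin ?ltr0n ?expn_gt0// natrX lnXn// -EFinM lee_fin.
  by rewrite -[(ln _ *+ _)%R]mulr_natl mulKf ?gt_eqF.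
apply: lee_wpmul2l; first by rewrite lee_fin invr_ge0.
rewrite lee_lne ?in_itv/= ?max_separated_ge0 ?leey ?lee_fin ?ler0n//.
exact: max_separated_skew_ge.
Qed.

End dynamics.

Theorem theorem4 (R : realType) :
  htop (skew_space R) (skew_product R) = (ln (2 : R)%R)%:E.
Proof.
apply: lim_near_cst; first exact: ereal_hausdorff.
near=> eps; apply/le_anti/andP; split.
  exact: separated_growth_skew_le.
apply: separated_growth_skew_ge; first exact: ltW.
by near: eps; exact: nbhs_right_lt.
Unshelve. all: by end_near.
Qed.
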